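(* Let $\sigma$ be a connection on $B(\mathcal{H})^+$ with representing function $f$ and associated measure $\mu$. Then the following statements are equivalent: (1) $\sigma$ satisfies the positivity property, i.e. for all $A,B\in B(\mathcal{H})^+$, $A,B>0 \implies A\,\sigma\,B>0$; (2) $I\,\sigma\,I>0$; (3) $\sigma\neq 0$, where $0$ denotes the zero connection $(A,B)\mapsto 0$; (4) for all $A\geq 0$, $A\,\sigma\,A=0 \implies A=0$; (5) for all $A\geq 0$, $A\,\sigma\,I=0 \implies A=0$; (6) for all $A\geq 0$, $I\,\sigma\,A=0 \implies A=0$; (7) for all $A\geq 0$ and $B>0$, $A\,\sigma\,B=0 \implies A=0$; (8) for all $A>0$ and $B\geq 0$, $A\,\sigma\,B=0 \implies B=0$; (9) $f\neq 0$, where $0$ denotes the function $x\mapsto 0$; (10) for all real $x$, $x>0 \implies f(x)>0$; (11) $\mu([0,1])>0$.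
   Context: $\mathcal{H}$ is a Hilbert space, $B(\mathcal{H})$ is the algebra of bounded linear operators on $\mathcal{H}$, $B(\mathcal{H})^+$ is the set of positive (i.e. positive semidefinite) operators, and $I$ is the identity operator. For Hermitian $A,B$, $A\leq B$ means $B-A\in B(\mathcal{H})^+$; $A\geq 0$ means $A\in B(\mathcal{H})^+$; $A>0$ means that $A$ is strictly positive, i.e. positive and invertible. $\mathbb{R}^+=[0,\infty)$. A connection is a binary operation $\sigma$ on $B(\mathcal{H})^+$ such that for all positive operators $A,B,C,D$: (M1) $A\leq C$, $B\leq D$ imply $A\,\sigma\,B\leq C\,\sigma\,D$; (M2) $C(A\,\sigma\,B)C\leq (CAC)\,\sigma\,(CBC)$; (M3) if $A_n,B_n\in B(\mathcal{H})^+$, $A_n\downarrow A$ and $B_n\downarrow B$, then $A_n\,\sigma\,B_n\downarrow A\,\sigma\,B$, where $A_n\downarrow A$ means that $(A_n)$ is a decreasing sequence converging strongly to $A$. A continuous function $f:\mathbb{R}^+\to\mathbb{R}^+$ is operator monotone if $A\leq B\implies f(A)\leq f(B)$ for all positive operators $A,B$ on any Hilbert space. Standing facts assumed about $\mathcal{H}$ (Kubo–Ando correspondence; it holds for example when $\mathcal{H}$ is infinite-dimensional): for every connection $\sigma$ on $B(\mathcal{H})^+$ there is a unique operator monotone function $f:\mathbb{R}^+\to\mathbb{R}^+$, called the representing function of $\sigma$, with $f(x)I=I\,\sigma\,(xI)$ for all $x\geq 0$, and $\sigma\mapsto f$ is a bijection from connections onto operator monotone functions $\mathbb{R}^+\to\mathbb{R}^+$;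 and there is a unique finite (positive) Borel measure $\mu$ on $[0,1]$, called the associated measure of $\sigma$, with $f(x)=\int_{[0,1]}(1\,!_t\,x)\,d\mu(t)$ for all $x\geq 0$, where $1\,!_t\,x=[(1-t)+t x^{-1}]^{-1}$ for $x>0$, and $1\,!_t\,0=\lim_{x\downarrow 0}1\,!_t\,x$ (equal to $0$ for $t\in(0,1]$ and to $1$ for $t=0$). Every finite Borel measure on $[0,1]$ arises in this way. *)

(* Defs.v *)
From HB Require Import structures.
From mathcomp Require Import all_boot all_order all_algebra.
From mathcomp Require Import complex.
From mathcomp Require Import all_classical all_reals all_analysis.

Set Implicit Arguments.
Unset Strict Implicit.
Unset Printing Implicit Defensive.

Import Order.TTheory GRing.Theory Num.Theory.
Import numFieldNormedType.Exports.

Local Open Scope classical_set_scope.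
Local Open Scope complex_scope.
Local Open Scope ring_scope.

(* Complex Hilbert spaces: complete normed spaces over R[i] whose norm comes
   from an inner product, linear in its first argument. *)
HB.mixin Record CompleteNormedModule_isHilbert (R : realType) (H : Type)
    of CompleteNormedModule R[i] H := {
  inner : {dot H for Num.conj} ;
  inner_normE : forall u : H, inner u u = `|u| ^+ 2
}.

#[short(type="hilbertType")]
HB.structure Definition Hilbert (R : realType) :=
  {H of CompleteNormedModule_isHilbert R H & CompleteNormedModule R[i] H}.

(* Operators are plain maps H -> H, with the pointwise vector space structure
   and equality; membership in B(H) and B(H)^+ is a predicate. *)
Section Operators.
Context {R : realType} {H : hilbertType R}.
Implicit Types A B : H -> H.

Definition bounded_op A : Prop :=
  linear A /\ exists M : R, forall v, `|A v| <= M%:C * `|v|.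

(* [0 <= z] in R[i] says that z is real and nonnegative *)
Definition positive_op A : Prop :=
  bounded_op A /\ forall v, 0 <= inner (A v) v.

Definition le_op A B : Prop := positive_op (B - A).

Definition invertible_op A : Prop :=
  exists2 B, bounded_op B & A \o B = idfun /\ B \o A = idfun.

Definition strictly_positive_op A : Prop := positive_op A /\ invertible_op A.

Definition scalar_op (z : R[i]) : H -> H := z *: (idfun : H -> H).

Definition decreases_to (A_ : nat -> H -> H) A : Prop :=
  (forall n, le_op (A_ n.+1) (A_ n)) /\
  (forall v, A_ n v @[n --> \oo] --> A v).

Definition spectrum A : set R[i] :=
  [set z | ~ invertible_op (A - scalar_op z)].

Definition poly_op (p : {poly R}) A : H -> H :=
  \sum_(i < size p) (p`_i)%:C *: (iter i A : H -> H).

(* Continuous functional calculus for positive A and real f continuous on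
   [0, +oo[ : f(A) is the norm limit of p(A) as the real polynomials p tend to
   f uniformly on the spectrum of A, which lies in [0, +oo[. For such A and f
   exactly one operator satisfies [is_fun_op f A]. *)
Definition is_fun_op (f : R -> R) A B : Prop :=
  bounded_op B /\ forall e : R, 0 < e -> exists p : {poly R},
    (forall x : R, spectrum A x%:C -> `|p.[x] - f x| <= e) /\
    (forall v, `|poly_op p A v - B v| <= e%:C * `|v|).

Definition fun_op (f : R -> R) A : H -> H := xget 0 [set B | is_fun_op f A B].

End Operators.

(* Functions on R^+ = [0, +oo[ are represented by functions on R, of which only
   the values on [0, +oo[ matter. *)
Definition operator_monotone (R : realType) (f : R -> R) : Prop :=
  [/\ {within `[0, +oo[, continuous f},
      forall x : R, 0 <= x -> 0 <= f x
    & forall (K : hilbertType R) (A B : K -> K),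
        positive_op A -> positive_op B -> le_op A B ->
        le_op (fun_op f A) (fun_op f B)].

(* A binary operation on B(H)^+ is represented by a total map, of which only
   the values on pairs of positive operators matter. *)
Definition binop (R : realType) (H : hilbertType R) : Type :=
  (H -> H) -> (H -> H) -> (H -> H).

Section Connections.
Context {R : realType} {H : hilbertType R}.
Implicit Types (sigma tau : binop H) (f : R -> R).

Definition connection sigma : Prop :=
  [/\ forall A B, positive_op A -> positive_op B -> positive_op (sigma A B),
      forall A B C D,
        positive_op A -> positive_op B -> positive_op C -> positive_op D ->
        le_op A C -> le_op B D -> le_op (sigma A B) (sigma C D),
      forall A B C, positive_op A -> positive_op B -> positive_op C ->
        le_op (C \o sigma A B \o C) (sigma (C \o A \o C) (C \o B \o C))
    & forall (A_ B_ : nat -> H -> H) A B,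
        (forall n, positive_op (A_ n)) -> (forall n, positive_op (B_ n)) ->
        positive_op A -> positive_op B ->
        decreases_to A_ A -> decreases_to B_ B ->
        decreases_to (fun n => sigma (A_ n) (B_ n)) (sigma A B)].

Definition eq_binop sigma tau : Prop :=
  forall A B, positive_op A -> positive_op B -> sigma A B = tau A B.

Definition zero_binop : binop H := fun _ _ => 0.

Definition representing_function sigma f : Prop :=
  operator_monotone f /\
  forall x : R, 0 <= x -> scalar_op (f x)%:C = sigma idfun (scalar_op x%:C).

End Connections.

(* 1 !_t x, the t-weighted harmonic mean of 1 and x, extended to x = 0 by
   continuity *)
Definition harmonic1 (R : realType) (t x : R) : R :=
  let h y := ((1 - t) + t * y^-1)^-1 in
  if 0 < x then h x else lim (h y @[y --> 0^'+]).

(* Finite Borel measures on [0, 1] are represented by finite Borel measures on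
   the line carried by [0, 1]. *)
Definition borel_measure (R : realType) : Type :=
  {finite_measure set (measurableTypeR R) -> \bar R}.

Definition unit_interval {R : realType} : set (measurableTypeR R) :=
  [set t : R | 0 <= t <= 1].

Definition on_unit_interval (R : realType) (mu : borel_measure R) : Prop :=
  mu (~` unit_interval) = 0%E.

Definition integral_representation (R : realType)
    (f : R -> R) (mu : borel_measure R) : Prop :=
  on_unit_interval mu /\
  forall x : R, 0 <= x ->
    (f x)%:E = (\int[mu]_(t in unit_interval) (harmonic1 t x)%:E)%E.

Definition associated_measure (R : realType) (H : hilbertType R)
    (sigma : binop H) (mu : borel_measure R) : Prop :=
  exists2 f, representing_function sigma f & integral_representation f mu.

(* The Kubo-Ando correspondence for H, a standing assumption on H. *)
Definition kubo_ando (R : realType) (H : hilbertType R) : Prop :=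
  [/\ forall sigma : binop H, connection sigma ->
        (exists f, representing_function sigma f) /\
        (forall f g, representing_function sigma f ->
           representing_function sigma g -> forall x, 0 <= x -> f x = g x),
      forall (sigma tau : binop H) f, connection sigma -> connection tau ->
        representing_function sigma f -> representing_function tau f ->
        eq_binop sigma tau,
      forall f : R -> R, operator_monotone f ->
        exists2 sigma : binop H, connection sigma &
          representing_function sigma f,
      forall sigma : binop H, connection sigma ->
        (exists mu, associated_measure sigma mu) /\
        (forall mu nu, associated_measure sigma mu ->
           associated_measure sigma nu ->
           forall E, measurable E -> mu E = nu E)
    & forall mu : borel_measure R, on_unit_interval mu ->
        exists2 sigma : binop H, connection sigma &
          associated_measure sigma mu].

(* Main.v *)
Require Import Defs.
From HB Require Import structures.
From mathcomp Require Import all_boot all_order all_algebra.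
From mathcomp Require Import complex.
From mathcomp Require Import all_classical all_reals all_analysis.
From mathcomp Require Import ring lra.

Set Implicit Arguments.
Unset Strict Implicit.
Unset Printing Implicit Defensive.

Import Order.TTheory GRing.Theory Num.Theory.
Import numFieldNormedType.Exports.

Local Open Scope classical_set_scope.
Local Open Scope ring_scope.

(** Each of the eleven conditions says that the number [f 1] is positive, where
    [sigma I I = f(1) I].

    Two estimates carry the proof; both come from monotonicity and the
    transformer inequality [C (A sigma B) C <= (CAC) sigma (CBC)].
    - [connection_square]: [f(1) C^2 <= C^2 sigma C^2], the transformer
      inequality at [A = B = I]. When [C] is a scalar, [A, B >= c I] gives
      [A sigma B >= c f(1) I] ([connection_lb]), hence the positivity property
      and the positivity of [f] on the positive reals. When [C] is a small
      multiple of an operator [D] dominated by both [A] and [B], then [C^2] is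
      below [A] and [B], because [D^2 <= M D] for [D <= M I]; so
      [A sigma B = 0] forces [D = 0] ([connection_eq0_inv]). This gives
      definiteness on the diagonal and in either variable.
    - [connection_eq0]: [A sigma B <= KI sigma KI <= K f(1) I] when
      [A, B <= K I], so [f(1) = 0] makes [sigma] vanish. This contradicts each
      of the conditions, since [H] is not zero.

    The measure enters through its total mass only, because the integrand is
    constant at [x = 1], so that [f(1) = mu([0,1])]
    ([integral_representation1]).

    If [H] were zero, the zero operator would be strictly positive and the
    theorem would fail. The Kubo-Ando correspondence excludes it: on the zero
    space there is only one binary operation, which would have both the zero
    measure and a point mass associated with it ([kubo_ando_nontrivial]).

    All operator inequalities are reduced to real inequalities between the
    quadratic forms [qform A v = <Av, v>] and [normsq v = |v|^2]. The operator
    theory behind them is the estimate [|Av|^2 <= M <Av, v>] for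
    [0 <= A <= M I] ([positive_normsq_le]) and the equivalence between strict
    positivity and a lower bound [A >= c I] with [c > 0]
    ([strictly_positive_lb], [coercive_strictly_positive]). *)

(** * Real quadratic forms on a complex Hilbert space *)
Section QuadraticForms.
Context {R : realType} {H : hilbertType R}.
Implicit Types (A B C : H -> H) (u v w : H) (a b c K M : R).

Definition qform A v : R := complex.Re (inner (A v) v).

Definition normsq v : R := complex.Re (inner v v).

Lemma ReB (x y : R[i]) : complex.Re (x - y) = complex.Re x - complex.Re y.
Proof. by case: x y => [? ?] [? ?]. Qed.

Lemma ReZ a (x : R[i]) : complex.Re (a%:C%C * x) = a * complex.Re x.
Proof. by case: x => [? ?] /=; rewrite mul0r subr0. Qed.

Lemma Re_conj (x : R[i]) : complex.Re x^* = complex.Re x.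
Proof. by case: x. Qed.

Lemma innerC u v : inner u v = (inner v u)^*.
Proof. by rewrite hermC mul1r. Qed.

Lemma innerZl (z : R[i]) u v : inner (z *: u) v = z * inner u v.
Proof. by rewrite linearZl_LR. Qed.

Lemma innerZr (z : R[i]) u v : inner u (z *: v) = z^* * inner u v.
Proof. by rewrite linearZr_LR. Qed.

Lemma Re_innerZr a u v :
  complex.Re (inner u (a%:C%C *: v)) = a * complex.Re (inner u v).
Proof. by rewrite innerC Re_conj innerZl ReZ innerC Re_conj. Qed.

Lemma normsqE v : (normsq v)%:C%C = `|v| ^+ 2.
Proof.
rewrite -inner_normE /normsq RRe_real// inner_normE.
by rewrite ger0_real// exprn_ge0.
Qed.

Lemma normsq_ge0 v : 0 <= normsq v.
Proof. by rewrite -lecR normsqE exprn_ge0. Qed.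

Lemma normsq_le0 v : normsq v <= 0 -> v = 0.
Proof.
move=> v_le0; have v0 : normsq v = 0 by apply/le_anti; rewrite v_le0 normsq_ge0.
by apply/eqP; rewrite -normr_eq0 -sqrf_eq0 -normsqE v0; exact: eqxx.
Qed.

Lemma normsq_gt0 v : v != 0 -> 0 < normsq v.
Proof. by apply: contra_neqT; rewrite -leNgt; exact: normsq_le0. Qed.

Lemma normsqZ a v : normsq (a%:C%C *: v) = a ^+ 2 * normsq v.
Proof.
apply: complexI; rewrite rmorphM rmorphXn /= !normsqE normrZ exprMn.
by rewrite -normrX ger0_norm// -rmorphXn lecR sqr_ge0.
Qed.

Lemma normsqB u v :
  normsq (u - v) = normsq u - complex.Re (inner u v) *+ 2 + normsq v.
Proof.
rewrite /normsq linearBl /= !linearBr /= [inner v u]innerC !ReB Re_conj mulr2n.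
by ring.
Qed.

Lemma normsqBC u v : normsq (u - v) = normsq (v - u).
Proof. by apply: complexI; rewrite !normsqE distrC. Qed.

Lemma normsqB_le u v : normsq (u - v) <= (normsq u + normsq v) *+ 2.
Proof.
(* parallelogram law: the missing term is the square norm of u + v *)
have := normsq_ge0 (u - (- 1)%:C%C *: v).
by rewrite !normsqB Re_innerZr normsqZ !mulr2n; lra.
Qed.

(** * Bounded and positive operators *)

Lemma linear_opB A u v : linear A -> A (u - v) = A u - A v.
Proof. by move=> lA; rewrite addrC -scaleN1r lA scaleN1r addrC. Qed.

Lemma linear_opZ A (z : R[i]) u : linear A -> A (z *: u) = z *: A u.
Proof.
move=> lA; have A0 : A 0 = 0 by have := linear_opB 0 0 lA; rewrite !subrr.
by rewrite -[z *: u]addr0 lA A0 addr0.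
Qed.

Lemma linear_opD A u v : linear A -> A (u + v) = A u + A v.
Proof. by move=> lA; rewrite -{1}[u]scale1r lA scale1r. Qed.

Lemma bounded_normsq A : bounded_op A ->
  exists2 K, 0 < K & forall v, normsq (A v) <= K * normsq v.
Proof.
move=> [_ [M AM]]; exists (M ^+ 2 + 1) => [|v].
  by rewrite ltr_wpDl// sqr_ge0.
apply: (@le_trans _ _ (M ^+ 2 * normsq v)); last first.
  by rewrite ler_wpM2r ?normsq_ge0// lerDl.
rewrite -lecR rmorphM rmorphXn /= !normsqE -exprMn.
by rewrite lerXn2r ?nnegrE// (le_trans _ (AM v)).
Qed.

Lemma normsq_bounded A K : linear A -> 0 <= K ->
  (forall v, normsq (A v) <= K * normsq v) -> bounded_op A.
Proof.
move=> lA K0 AK; split=> //; exists (Num.sqrt K) => v.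
rewrite -(@ler_pXn2r _ 2) ?nnegrE ?mulr_ge0 ?lecR ?sqrtr_ge0//.
by rewrite exprMn -!normsqE -rmorphXn sqr_sqrtr// -rmorphM lecR.
Qed.

Lemma bounded_opZ (z : R[i]) A : bounded_op A -> bounded_op (z *: A).
Proof.
move=> [lA [M AM]]; split.
  move=> a u v; change (z *: A (a *: u + v) = a *: (z *: A u) + z *: A v).
  by rewrite lA scalerDr !scalerA mulrC.
have /complex_realP[a za] : `|z| \is Num.real by [].
exists (a * M) => v; change (`|z *: A v| <= (a * M)%:C%C * `|v|).
by rewrite normrZ rmorphM /= -za -mulrA ler_wpM2l.
Qed.

Lemma bounded_opB A B : bounded_op A -> bounded_op B -> bounded_op (A - B).
Proof.
move=> [lA [M AM]] [lB [N BN]]; split.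
  move=> a u v.
  change (A (a *: u + v) - B (a *: u + v) = a *: (A u - B u) + (A v - B v)).
  by rewrite lA lB scalerBr opprD addrACA.
exists (M + N) => v; change (`|A v - B v| <= (M + N)%:C%C * `|v|).
by rewrite rmorphD /= mulrDl (le_trans (ler_normB _ _))// lerD.
Qed.

Lemma positive_opE A v : positive_op A -> inner (A v) v = (qform A v)%:C%C.
Proof. by move=> [_ /(_ v) /ger0_real /RRe_real]. Qed.

Lemma qform_ge0 A v : positive_op A -> 0 <= qform A v.
Proof. by move=> pA; have := pA.2 v; rewrite positive_opE// lecR. Qed.

Lemma le_opP A B : positive_op A -> positive_op B ->
  (le_op A B <-> forall v, qform A v <= qform B v).
Proof.
move=> pA pB.
have E v : inner ((B - A) v) v = (qform B v - qform A v)%:C%C.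
  change (inner (B v - A v) v = (qform B v - qform A v)%:C%C).
  by rewrite linearBl /= !positive_opE// rmorphB.
split=> [[_ AB] v|AB]; first by have := AB v; rewrite E lecR subr_ge0.
split; first exact: bounded_opB pB.1 pA.1.
by move=> v; rewrite E lecR subr_ge0.
Qed.

Lemma qformZ c A v : qform (c%:C%C *: A) v = c * qform A v.
Proof. by rewrite /qform -ReZ -innerZl. Qed.

Lemma positive_opZ c A : 0 <= c -> positive_op A -> positive_op (c%:C%C *: A).
Proof.
move=> c0 pA; split; first exact: bounded_opZ pA.1.
move=> v; change (0 <= inner (c%:C%C *: A v) v).
by rewrite innerZl mulr_ge0 ?lecR// pA.2.
Qed.

Lemma positive_idfun : positive_op (idfun : H -> H).
Proof.
split; last by move=> v; rewrite /= inner_normE exprn_ge0.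
by split=> [a u v|]//; exists 1 => v; rewrite mul1r.
Qed.

Lemma positive_scalar c : 0 <= c -> positive_op (scalar_op c%:C%C : H -> H).
Proof. by move=> c0; apply: positive_opZ => //; exact: positive_idfun. Qed.

Lemma qform_scalar c v : qform (scalar_op c%:C%C) v = c * normsq v.
Proof. by rewrite [LHS]qformZ. Qed.

Lemma scalar_op1 : scalar_op 1%:C%C = idfun :> (H -> H).
Proof. by apply/funext => v; rewrite /scalar_op; exact: scale1r. Qed.

(** Polarization: [<A(u + zv), u + zv>] is real for every complex [z]; taking
    [z = 1] and [z = i] shows that the two cross terms are conjugate. *)
Lemma positive_selfadjoint A u v : positive_op A ->
  inner (A u) v = inner u (A v).
Proof.
move=> pA; have lA := pA.1.1; rewrite [RHS]innerC.
have E (z : R[i]) : inner (A (u + z *: v)) (u + z *: v) =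
    inner (A u) u + z * z^* * inner (A v) v
    + (z^* * inner (A u) v + z * inner (A v) u).
  rewrite linear_opD// linear_opZ// linearDl !linearDr /= !innerZl !innerZr.
  by ring.
have /ger0_Im := pA.2 (u + 1 *: v); rewrite E !positive_opE//.
have /ger0_Im := pA.2 (u + 'i%C *: v); rewrite E !positive_opE//.
case: (inner (A u) v) => a b; case: (inner (A v) u) => c d /= h1 h2.
by congr (_ +i* _)%C; lra.
Qed.

Lemma qformB A u v : positive_op A ->
  qform A (u - v) = qform A u - complex.Re (inner (A u) v) *+ 2 + qform A v.
Proof.
move=> pA; rewrite /qform linear_opB; last exact: pA.1.1.
rewrite linearBl /= !linearBr /= [inner (A v) u]positive_selfadjoint//.
by rewrite [inner v _]innerC !ReB Re_conj mulr2n; ring.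
Qed.

Lemma qform_scale A c v : positive_op A ->
  qform A (c%:C%C *: v) = c ^+ 2 * qform A v.
Proof.
move=> pA; rewrite /qform linear_opZ; last exact: pA.1.1.
by rewrite innerZl ReZ Re_innerZr mulrA.
Qed.

(** The operator inequality [A^2 <= M A] for [0 <= A <= M I], obtained by
    expanding [0 <= <A(Mv - Av), Mv - Av>] and bounding [<A(Av), Av>] by
    [M |Av|^2]. *)
Lemma positive_normsq_le A M : positive_op A -> 0 < M ->
  (forall v, qform A v <= M * normsq v) ->
  forall v, normsq (A v) <= M * qform A v.
Proof.
move=> pA M0 AM v; set w := A v.
have := qform_ge0 (M%:C%C *: v - w) pA.
rewrite qformB// qform_scale// linear_opZ; last exact: pA.1.1.
rewrite innerZl ReZ -/w -/(normsq w) mulr2n.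
have Aw := AM w; move=> h; rewrite -(ler_pM2l M0).
by rewrite expr2 -mulrA in h; lra.
Qed.

Lemma positive_op_ub A : positive_op A ->
  exists2 M, 0 < M & forall v, qform A v <= M * normsq v.
Proof.
move=> pA; have [K K0 AK] := bounded_normsq pA.1.
exists (K + 1) => [|v]; first by rewrite addr_gt0.
(* 2 <Av, v> <= |Av|^2 + |v|^2 *)
have := normsq_ge0 (A v - v); rewrite normsqB -/(qform A v) mulr2n.
by have := AK v; have := normsq_ge0 v; have := qform_ge0 v pA; lra.
Qed.

Lemma positive_op_eq0 A : positive_op A -> (forall v, qform A v <= 0) -> A = 0.
Proof.
move=> pA A0; apply/funext => v; apply: normsq_le0.
rewrite (le_trans (@positive_normsq_le _ 1 pA ltr01 _ v))//.
  by move=> w; rewrite (le_trans (A0 w))// mulr_ge0// normsq_ge0.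
by rewrite mul1r.
Qed.

Lemma qform_conj A C v : positive_op C ->
  qform (C \o A \o C) v = qform A (C v).
Proof. by move=> pC; rewrite /qform /= positive_selfadjoint. Qed.

Lemma qform_square C v : positive_op C -> qform (C \o C) v = normsq (C v).
Proof. exact: (@qform_conj idfun). Qed.

Lemma positive_op_conj A C : positive_op A -> positive_op C ->
  positive_op (C \o A \o C).
Proof.
move=> pA pC; split; last first.
  by move=> v /=; rewrite positive_selfadjoint//; exact: pA.2.
have [K K0 CK] := bounded_normsq pC.1; have [L L0 AL] := bounded_normsq pA.1.
apply: (@normsq_bounded _ (K * (L * K))).
- by move=> z u v /=; rewrite pC.1.1 pA.1.1 pC.1.1.
- by rewrite !mulr_ge0// ltW.
- move=> v /=; rewrite (le_trans (CK _))// -!mulrA ler_pM2l//.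
  by rewrite (le_trans (AL _))// ler_pM2l.
Qed.

Lemma positive_op_square C : positive_op C -> positive_op (C \o C).
Proof. move=> pC; exact: (positive_op_conj positive_idfun pC). Qed.

End QuadraticForms.

(** * Strict positivity as a lower bound *)
Section StrictPositivity.
Context {R : realType} {H : hilbertType R}.
Implicit Types (A B : H -> H) (v : H) (c M : R).

(** If [B] is the inverse of [A], then [|v|^2 = |BAv|^2 <= K |Av|^2], and
    [|Av|^2] is at most [M <Av, v>]. *)
Lemma strictly_positive_lb A : strictly_positive_op A ->
  exists2 c, 0 < c & forall v, c * normsq v <= qform A v.
Proof.
move=> [pA [B bB [_ BA]]].
have [M M0 AM] := positive_op_ub pA; have [K K0 BK] := bounded_normsq bB.
exists (K * M)^-1 => [|v]; first by rewrite invr_gt0 mulr_gt0.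
rewrite ler_pdivrMl ?mulr_gt0//.
have -> : v = B (A v) by rewrite -[LHS]/(idfun v) -BA.
rewrite (le_trans (BK _))// -mulrA ler_pM2l//.
have -> : B (A v) = v by rewrite -[RHS]/(idfun v) -BA.
exact: positive_normsq_le.
Qed.

(** Expand [0 <= |Av - cv|^2]. *)
Lemma coercive_normsq A c : 0 < c ->
  (forall v, c * normsq v <= qform A v) ->
  forall v, c ^+ 2 * normsq v <= normsq (A v).
Proof.
move=> c0 Ac v; have := normsq_ge0 (A v - c%:C%C *: v).
rewrite normsqB Re_innerZr -/(qform A v) normsqZ mulr2n.
have : c * (c * normsq v) <= c * qform A v by rewrite ler_pM2l.
by rewrite expr2 -mulrA; lra.
Qed.

(** An operator that is bounded below has closed range: approximate solutions
    of [A x = y] form a Cauchy sequence, because their images do. *)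
Lemma bounded_below_solution A c y (s : nat -> H) : bounded_op A -> 0 < c ->
  (forall v, c * normsq v <= normsq (A v)) ->
  (forall e : R, 0 < e -> \forall n \near \oo, normsq (y - A (s n)) < e) ->
  exists x, A x = y.
Proof.
move=> bA c0 Ac sy; have lA := bA.1.
have ds n m : normsq (s n - s m) <=
    c^-1 * ((normsq (y - A (s n)) + normsq (y - A (s m))) *+ 2).
  rewrite ler_pdivlMl// (le_trans (Ac _))// (linear_opB _ _ lA).
  rewrite (le_trans _ (normsqB_le _ _))// normsqBC.
  suff -> : y - A (s n) - (y - A (s m)) = A (s m) - A (s n) by [].
  by rewrite opprB addrC addrA subrK.
have cs : cvg (s @ \oo).
  apply/cauchy_cvgP/cauchy_ballP => e e0; rewrite near_map2.
  (* a positive element of R[i] is a positive real *)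
  have [e' ee'] : exists e', e = e'%:C%C by apply/complex_realP/gtr0_real.
  have e'0 : 0 < e' by rewrite -ltcR -ee'.
  have d0 : 0 < c * e' ^+ 2 / 4 by rewrite divr_gt0// mulr_gt0// exprn_gt0.
  near=> n m => /=.
  rewrite -ball_normE/= -(@ltr_pXn2r _ 2)// ?nnegrE ?(ltW e0)//.
  rewrite ee' -rmorphXn -normsqE ltcR (le_lt_trans (ds n m))//.
  rewrite ltr_pdivrMl//.
  have sn : normsq (y - A (s n)) < c * e' ^+ 2 / 4 by near: n; exact: sy.
  have sm : normsq (y - A (s m)) < c * e' ^+ 2 / 4 by near: m; exact: sy.
  by rewrite mulr2n; lra.
have [L L0 AL] := bounded_normsq bA.
exists (lim (s @ \oo)); apply/esym/eqP; rewrite -subr_eq0; apply/eqP.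
apply: normsq_le0; apply/ler_addgt0Pr => e e0; rewrite add0r.
have e40 : 0 < e / 4 by rewrite divr_gt0.
have eL : 0 < Num.sqrt (e / 4 / L) by rewrite sqrtr_gt0 divr_gt0.
near \oo => n.
have sn : normsq (s n - lim (s @ \oo)) < e / 4 / L.
  rewrite -ltcR normsqE -[X in X%:C%C]sqr_sqrtr ?ltW ?divr_gt0//.
  rewrite rmorphXn ltr_pXn2r ?nnegrE ?lecR ?sqrtr_ge0//.
  by rewrite distrC; near: n; move/cvgrPdist_lt : cs; apply; rewrite ltcR.
have rn : normsq (y - A (s n)) < e / 4 by near: n; exact: sy.
have -> : y - A (lim (s @ \oo)) = y - A (s n) - A (lim (s @ \oo) - s n).
  by rewrite (linear_opB _ _ lA) opprB addrA subrK.
rewrite (le_trans (normsqB_le _ _))//.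
have := AL (lim (s @ \oo) - s n); rewrite normsqBC.
have : L * normsq (s n - lim (s @ \oo)) <= e / 4.
  by rewrite mulrC -ler_pdivlMr// ltW.
by move=> ? ?; rewrite mulr2n; lra.
Unshelve. all: by end_near. Qed.

(** Richardson iteration: if [c I <= A <= M I], the residual [y - A x] of
    [A x = y] is multiplied by [S = I - A / M] when [x] is corrected by
    [(y - A x) / M], and [0 <= S <= q I] with [q = 1 - c / M] gives
    [|Sv| <= q |v|]. *)
Lemma coercive_surjective A c : positive_op A -> 0 < c ->
  (forall v, c * normsq v <= qform A v) -> forall y, exists x, A x = y.
Proof.
move=> pA c0 Ac y; have lA := pA.1.1.
(* M exceeds the upper bound K by c, so that q is not 0 *)
have [K K0 AK] := positive_op_ub pA; pose M := K + c.
have M0 : 0 < M by rewrite addr_gt0.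
pose q := 1 - c / M.
have q0 : 0 < q by rewrite subr_gt0 ltr_pdivrMr// mul1r ltrDr.
have q1 : q < 1 by rewrite ltrBlDr ltrDl divr_gt0.
pose S : H -> H := idfun - M^-1%:C%C *: A.
have SE v : S v = v - M^-1%:C%C *: A v by [].
have qS v : qform S v = normsq v - M^-1 * qform A v.
  by rewrite /qform SE linearBl /= innerZl ReB ReZ.
have pS : positive_op S.
  apply/(@le_opP _ _ (M^-1%:C%C *: A) idfun); first 2 last.
  - move=> v; rewrite qformZ mulrC ler_pdivrMr// mulrC.
    by rewrite (le_trans (AK v))// ler_wpM2r ?normsq_ge0// lerDl ltW.
  - by apply: positive_opZ pA; rewrite invr_ge0 ltW.
  - exact: positive_idfun.
have Sq v : qform S v <= q * normsq v.
  by rewrite qS mulrBl mul1r lerD2l lerN2 mulrAC mulrC ler_pM2l ?invr_gt0// Ac.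
have rate v : normsq (S v) <= q ^+ 2 * normsq v.
  by rewrite (le_trans (positive_normsq_le pS q0 Sq v))// expr2 -mulrA ler_pM2l.
pose s := fix s n :=
  if n is n'.+1 then s n' + M^-1%:C%C *: (y - A (s n')) else 0.
have sE n : s n.+1 = s n + M^-1%:C%C *: (y - A (s n)) by [].
pose r n := y - A (s n).
have rS n : r n.+1 = S (r n).
  rewrite SE /r sE [A (s n + _)](linear_opD _ _ lA) (linear_opZ _ _ lA).
  by rewrite opprD addrA.
have rq n : normsq (r n) <= (q ^+ 2) ^+ n * normsq (r 0%N).
  elim: n => [|n IHn]; first by rewrite expr0 mul1r.
  rewrite rS (le_trans (rate _))// [_ ^+ n.+1]exprS -mulrA.
  by rewrite ler_wpM2l// sqr_ge0.
apply: (@bounded_below_solution A _ y s pA.1 (exprn_gt0 2 c0)).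
  exact: coercive_normsq.
move=> e e0; have : (q ^+ 2) ^+ n * normsq (r 0%N) @[n --> \oo] --> (0 : R).
  rewrite -(mul0r (normsq (r 0%N))); apply: cvgMl; apply: cvg_expr.
  by rewrite ger0_norm ?sqr_ge0// expr_lt1// ltW.
move=> /cvgrPdist_lt/(_ _ e0); apply: filterS => n.
rewrite sub0r normrN => h; apply: le_lt_trans h.
by rewrite (le_trans (rq n))// ler_norm.
Qed.

Lemma coercive_strictly_positive A c : positive_op A -> 0 < c ->
  (forall v, c * normsq v <= qform A v) -> strictly_positive_op A.
Proof.
move=> pA c0 Ac; split=> //; have lA := pA.1.1.
have [B AB] := choice (coercive_surjective pA c0 Ac).
have injA u v : A u = A v -> u = v.
  move=> Auv; apply/eqP; rewrite -subr_eq0; apply/eqP/normsq_le0.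
  rewrite -(pmulr_rle0 _ (exprn_gt0 2 c0)) (le_trans (coercive_normsq c0 Ac _))//.
  by rewrite (linear_opB _ _ lA) Auv subrr /normsq linear0l.
exists B; last by split; apply/funext => v //=; apply: injA; rewrite AB.
apply: (@normsq_bounded _ _ _ (c ^+ 2)^-1).
- by move=> z u v; apply: injA; rewrite AB lA !AB.
- by rewrite invr_ge0 sqr_ge0.
- move=> v; rewrite ler_pdivlMl ?exprn_gt0//.
  by rewrite (le_trans (coercive_normsq c0 Ac _))// AB.
Qed.

(** Since [A <= M I] and [b I <= B], the multiple [min(1, b / M) A] lies below
    both [A] and [B]. *)
Lemma dominated_below A B : positive_op A -> strictly_positive_op B ->
  exists2 c, 0 < c & forall v,
    c * qform A v <= qform A v /\ c * qform A v <= qform B v.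
Proof.
move=> pA spB; have [M M0 AM] := positive_op_ub pA.
have [b b0 Bb] := strictly_positive_lb spB.
exists (Num.min 1 (b / M)) => [|v].
  by rewrite lt_min ltr01 divr_gt0.
split; first by rewrite ler_piMl ?qform_ge0// ge_min lexx.
rewrite (le_trans _ (Bb v))//.
apply: (@le_trans _ _ (b / M * qform A v)).
  by rewrite ler_wpM2r ?qform_ge0// ge_min lexx orbT.
by rewrite -mulrA ler_pM2l// ler_pdivrMl.
Qed.

End StrictPositivity.

(** * Estimates for connections *)
Section ConnectionEstimates.
Context {R : realType} {H : hilbertType R} {sigma : binop H} {f : R -> R}.
Context (csigma : connection sigma) (fsigma : representing_function sigma f).
Implicit Types (A B C D : H -> H) (v : H) (c : R).

Lemma connection_idfun : sigma idfun idfun = scalar_op (f 1)%:C%C.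
Proof. by rewrite (fsigma.2 1 ler01) scalar_op1. Qed.

Lemma connection_positive A B :
  positive_op A -> positive_op B -> positive_op (sigma A B).
Proof. by case: csigma => + _ _ _; apply. Qed.

Lemma connection_mono A B C D : positive_op A -> positive_op B ->
  positive_op C -> positive_op D ->
  (forall v, qform A v <= qform C v) -> (forall v, qform B v <= qform D v) ->
  forall v, qform (sigma A B) v <= qform (sigma C D) v.
Proof.
move=> pA pB pC pD AC BD; case: csigma => _ mono _ _.
apply: (iffLR (le_opP (connection_positive pA pB) (connection_positive pC pD))).
by apply: mono => //; apply/le_opP.
Qed.

(** The transformer inequality at [I sigma I = f(1) I]. *)
Lemma connection_square C v : positive_op C ->
  f 1 * normsq (C v) <= qform (sigma (C \o C) (C \o C)) v.
Proof.
move=> pC; case: csigma => _ _ transf _.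
have pI : positive_op (idfun : H -> H) := positive_idfun.
have pCC := positive_op_square pC.
have pL := positive_op_conj (connection_positive pI pI) pC.
have := iffLR (le_opP pL (connection_positive pCC pCC))
  (transf _ _ _ pI pI pC) v.
by rewrite qform_conj// connection_idfun qform_scalar.
Qed.

Lemma connection_lb A B c : positive_op A -> positive_op B -> 0 <= c ->
  (forall v, c * normsq v <= qform A v) ->
  (forall v, c * normsq v <= qform B v) ->
  forall v, c * f 1 * normsq v <= qform (sigma A B) v.
Proof.
move=> pA pB c0 cA cB v.
pose C : H -> H := scalar_op (Num.sqrt c)%:C%C.
have pC : positive_op C by apply/positive_scalar/sqrtr_ge0.
have CE u : normsq (C u) = c * normsq u by rewrite normsqZ sqr_sqrtr.
have pCC := positive_op_square pC.
rewrite mulrAC mulrC -CE (le_trans (connection_square v pC))//.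
by apply: connection_mono => // u; rewrite qform_square// CE.
Qed.

(** Choose [K] with [A, B <= K I]; then [A sigma B <= KI sigma KI], and
    conjugating by the scalar [K^(-1/2)] bounds the right-hand side by a
    multiple of [I sigma I]. *)
Lemma connection_eq0 A B : f 1 = 0 -> positive_op A -> positive_op B ->
  sigma A B = 0.
Proof.
move=> f10 pA pB.
have [M M0 AM] := positive_op_ub pA; have [N N0 BN] := positive_op_ub pB.
pose K := Num.max M N; have K0 : 0 < K by rewrite lt_max M0.
have K1 : 0 <= K^-1 by rewrite invr_ge0 ltW.
pose C : H -> H := scalar_op (Num.sqrt K^-1)%:C%C.
have pC : positive_op C by apply/positive_scalar/sqrtr_ge0.
pose T : H -> H := scalar_op K%:C%C.
have pT : positive_op T by apply/positive_scalar/ltW.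
have CTC : C \o T \o C = idfun.
  apply/funext => v.
  change ((Num.sqrt K^-1)%:C%C *: (K%:C%C *: ((Num.sqrt K^-1)%:C%C *: v)) = v).
  rewrite !scalerA -!rmorphM /= mulrAC -expr2 sqr_sqrtr//.
  by rewrite mulVf ?gt_eqF//; exact: scale1r.
have pTT := connection_positive pT pT.
apply: positive_op_eq0 => [|v]; first exact: connection_positive.
apply: (@le_trans _ _ (qform (sigma T T) v)).
  apply: connection_mono => // u; rewrite qform_scalar.
    by rewrite (le_trans (AM u))// ler_wpM2r ?normsq_ge0// le_max lexx.
  by rewrite (le_trans (BN u))// ler_wpM2r ?normsq_ge0// le_max lexx orbT.
case: csigma => _ _ transf _.
have := transf _ _ _ pT pT pC; rewrite CTC connection_idfun f10.
have p0 : positive_op (scalar_op 0%:C%C : H -> H) := positive_scalar (lexx 0).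
move=> /(le_opP (positive_op_conj pTT pC) p0)/(_ v).
rewrite qform_conj// qform_scalar mul0r qform_scale// sqr_sqrtr//.
by rewrite pmulr_rle0// invr_gt0.
Qed.

(** With [C = sqrt(c / M) D] and [D <= M I], the inequality [D^2 <= M D] gives
    [C^2 <= c D <= A, B], hence [f(1) C^2 <= C^2 sigma C^2 <= A sigma B = 0]. *)
Lemma connection_eq0_inv A B D c : 0 < f 1 -> 0 < c -> positive_op D ->
  positive_op A -> positive_op B ->
  (forall v, c * qform D v <= qform A v) ->
  (forall v, c * qform D v <= qform B v) -> sigma A B = 0 -> D = 0.
Proof.
move=> f1 c0 pD pA pB DA DB AB0.
have [M M0 DM] := positive_op_ub pD.
pose t := Num.sqrt (c / M).
have t0 : 0 < t by rewrite sqrtr_gt0 divr_gt0.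
have t2 : t ^+ 2 = c / M by rewrite sqr_sqrtr// divr_ge0// ltW.
pose C := t%:C%C *: D.
have pC : positive_op C by apply: positive_opZ => //; exact: ltW.
have CC v : qform (C \o C) v <= c * qform D v.
  rewrite qform_square// normsqZ t2.
  by rewrite -mulrA ler_pM2l// ler_pdivrMl// positive_normsq_le.
have pCC := positive_op_square pC.
apply/funext => v; apply: normsq_le0.
rewrite -(pmulr_rle0 _ (exprn_gt0 2 t0)) -normsqZ.
rewrite -(pmulr_rle0 _ f1) (le_trans (connection_square v pC))//.
apply: (@le_trans _ _ (qform (sigma A B) v)).
  by apply: connection_mono => // u; exact: le_trans (CC u) _.
by rewrite AB0 /qform linear0l.
Qed.

End ConnectionEstimates.

(** * The associated measure and the dimension of H *)

Lemma measurable_unit_interval (R : realType) : measurable (@unit_interval R).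
Proof.
have -> : @unit_interval R = [set` `[0, 1]].
  by apply/seteqP; split=> x /=; rewrite in_itv.
exact: measurable_itv.
Qed.

(** The harmonic means [1 !_t 1] are all equal to 1. *)
Lemma integral_representation1 (R : realType) (g : R -> R)
    (mu : borel_measure R) :
  integral_representation g mu -> (g 1)%:E = mu unit_interval.
Proof.
move=> [_ /(_ 1 ler01) ->].
under eq_integral do rewrite /harmonic1 ltr01 invr1 mulr1 subrK invr1.
by rewrite integral_cst ?mul1e//; exact: measurable_unit_interval.
Qed.

Lemma kubo_ando_nontrivial (R : realType) (H : hilbertType R) :
  kubo_ando H -> exists v : H, v != 0.
Proof.
move=> [repr _ _ _ meas]; apply/not_existsP => H0.
have allE (A B : H -> H) : A = B.
  have E (u : H) : u = 0 by apply/eqP/negPn/negP/H0.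
  by apply/funext => v; rewrite [LHS]E [RHS]E.
(* the zero measure and the unit mass at 0 give representing functions of the
   same connection with the values 0 and 1 at the point 1 *)
have [s0 cs0 [f0 rf0 /integral_representation1 If0]] :=
  meas (mzero : borel_measure R) erefl.
have d0 : on_unit_interval (\d_(0 : measurableTypeR R) : borel_measure R).
  rewrite /on_unit_interval /= diracE memNset// => nI; apply: nI.
  by rewrite /unit_interval /= lexx ler01.
have [s1 cs1 [f1 rf1 /integral_representation1 If1]] := meas _ d0.
have s01 : s0 = s1 by do 2!apply/funext => ?; exact: allE.
have f01 : f0 1 = f1 1.
  by apply: (repr s0 cs0).2 => //; rewrite s01.
move: If1; rewrite -f01 If0 /= /mzero diracE mem_set; last first.
  by rewrite /unit_interval /= lexx ler01.
by move=> /eqP; rewrite lt_eqF.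
Qed.

(** * The equivalence *)
Theorem theorem2p1 (R : realType) (H : hilbertType R)
    (sigma : binop H) (f : R -> R) (mu : borel_measure R) :
  kubo_ando H ->
  connection sigma ->
  representing_function sigma f ->
  associated_measure sigma mu ->
  [<-> forall A B, strictly_positive_op A -> strictly_positive_op B ->
         strictly_positive_op (sigma A B);
       strictly_positive_op (sigma idfun idfun);
       ~ eq_binop sigma (@zero_binop R H);
       forall A, positive_op A -> sigma A A = 0 -> A = 0;
       forall A, positive_op A -> sigma A idfun = 0 -> A = 0;
       forall A, positive_op A -> sigma idfun A = 0 -> A = 0;
       forall A B, positive_op A -> strictly_positive_op B ->
         sigma A B = 0 -> A = 0;
       forall A B, strictly_positive_op A -> positive_op B ->
         sigma A B = 0 -> B = 0;
       ~ (forall x : R, 0 <= x -> f x = 0);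
       forall x : R, 0 < x -> 0 < f x;
       (0 < mu unit_interval)%E].
Proof.
move=> KA csigma fsigma musigma.
have [v0 v0_neq0] := kubo_ando_nontrivial KA.
have pI : positive_op (idfun : H -> H) := positive_idfun.
have spI : strictly_positive_op (idfun : H -> H).
  by apply: (coercive_strictly_positive pI ltr01) => v; rewrite mul1r.
have scalar_inj (a b : R) :
    scalar_op a%:C%C = scalar_op b%:C%C :> (H -> H) -> a = b.
  move=> /(congr1 (fun T => qform T v0)); rewrite !qform_scalar.
  by apply: mulIf; rewrite gt_eqF// normsq_gt0.
have scalar_op0 : scalar_op 0%:C%C = 0 :> (H -> H).
  by apply/funext => v; exact: scale0r.
have idfun_neq0 : (idfun : H -> H) <> 0.
  by rewrite -scalar_op1 -scalar_op0 => /scalar_inj/eqP; rewrite oner_eq0.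
have f1_dichotomy : f 1 = 0 \/ 0 < f 1.
  have := fsigma.1 => -[_ /(_ 1 ler01) + _].
  by rewrite le_eqVlt => /predU1P[<-|]; [left|right].
have mu_f1 : mu unit_interval = (f 1)%:E.
  have [g [_ gsigma] /integral_representation1 <-] := musigma.
  congr EFin; apply: scalar_inj.
  by rewrite gsigma// scalar_op1 (connection_idfun fsigma).
have sigma_gt0 : sigma idfun idfun <> 0 -> 0 < f 1.
  by case: f1_dichotomy => // f10 []; exact: (connection_eq0 csigma fsigma f10).
have definite_l A B : 0 < f 1 -> positive_op A -> strictly_positive_op B ->
    sigma A B = 0 -> A = 0.
  move=> f1 pA spB; have [c c0 cA] := dominated_below pA spB.
  by apply: (connection_eq0_inv csigma fsigma f1 c0 pA pA spB.1) => v; have [] := cA v.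
have definite_r A B : 0 < f 1 -> strictly_positive_op A -> positive_op B ->
    sigma A B = 0 -> B = 0.
  move=> f1 spA pB; have [c c0 cB] := dominated_below pB spA.
  by apply: (connection_eq0_inv csigma fsigma f1 c0 pB spA.1 pB) => v; have [] := cB v.
tfae.
- by apply.
- move=> [_ [T _ [TI _]]] sigma0; apply: idfun_neq0; rewrite -TI.
  by rewrite sigma0.
- move=> sigma_neq0.
  have f1 : 0 < f 1.
    case: f1_dichotomy => // f10; case: sigma_neq0 => A B pA pB.
    exact: (connection_eq0 csigma fsigma f10).
  move=> A pA; apply: (connection_eq0_inv csigma fsigma f1 ltr01 pA pA pA) => v.
    by rewrite mul1r.
  by rewrite mul1r.
- move=> h A pA; apply: definite_l => //; apply: sigma_gt0.
  by move=> /(h _ pI).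
- move=> h A pA; apply: definite_r => //; apply: sigma_gt0.
  by move=> /(h _ pI).
- move=> h A B pA spB; apply: definite_l => //; apply: sigma_gt0.
  by move=> /(h _ pI).
- move=> h A B spA pB; apply: definite_r => //; apply: sigma_gt0.
  by move=> /(h _ _ pI spI).
- move=> h f0; suff /sigma_gt0 : sigma idfun idfun <> 0 by rewrite f0// ltxx.
  by move=> /(h _ _ spI pI).
- move=> f_neq0.
  have f1 : 0 < f 1.
    case: f1_dichotomy => // f10; case: f_neq0 => x x0; apply: scalar_inj.
    rewrite fsigma.2// scalar_op0; apply: (connection_eq0 csigma fsigma f10 pI).
    exact: positive_scalar.
  move=> x x0; have xI := positive_scalar (H := H) (ltW x0).
  pose c := Num.min 1 x; have c0 : 0 < c by rewrite lt_min ltr01.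
  have := @connection_lb _ _ _ _ csigma fsigma idfun _ c pI xI (ltW c0).
  rewrite -fsigma.2; last exact: ltW.
  move=> lb; rewrite -(pmulr_lgt0 _ (normsq_gt0 v0_neq0)) -qform_scalar.
  apply: lt_le_trans (lb _ _ v0); first by rewrite !mulr_gt0// normsq_gt0.
    by move=> v; rewrite ler_piMl ?normsq_ge0// /c ge_min lexx.
  by move=> v; rewrite qform_scalar ler_wpM2r ?normsq_ge0// /c ge_min lexx orbT.
- by move=> fpos; rewrite mu_f1 lte_fin; exact: fpos.
- rewrite mu_f1 lte_fin => f1 A B spA spB.
  have [a a0 Aa] := strictly_positive_lb spA.
  have [b b0 Bb] := strictly_positive_lb spB.
  pose c := Num.min a b; have c0 : 0 < c by rewrite lt_min a0.
  have pAB := connection_positive csigma spA.1 spB.1.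
  apply: (coercive_strictly_positive pAB (mulr_gt0 c0 f1)).
  apply: (connection_lb csigma fsigma spA.1 spB.1 (ltW c0)) => v.
    by rewrite (le_trans _ (Aa v))// ler_wpM2r ?normsq_ge0// ge_min lexx.
  by rewrite (le_trans _ (Bb v))// ler_wpM2r ?normsq_ge0// ge_min lexx orbT.
Qed.
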